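(* Let $n\ge 2$. (i) Any interval in $\mathscr{C}_n$ is a distributive lattice, with the reduced parenthesizations of the join and meet of trees $T_1$ and $T_2$ in an interval given by the ordinary union and intersection, respectively, of the parenthesis pairs from $RP_{T_1}$ and $RP_{T_2}$. (ii) In $\mathscr{C}_n$, $T_1$ covers $T_2$ if and only if $RP_{T_1}$ can be obtained from $RP_{T_2}$ by adding one parenthesis pair. (iii) $\mathscr{C}_n$ is a ranked poset, with the rank of any tree $T$ in $\mathscr{C}_n$ given by the number of parenthesis pairs in $RP_T$. (iv) For any two trees $T_1$ and $T_2$ that are in the same interval of $\mathscr{C}_n$, $$\mathrm{rank}(T_1)+\mathrm{rank}(T_2)=\mathrm{rank}(T_1\wedge T_2)+\mathrm{rank}(T_1\vee T_2).$$ (v) For any tree $T\in\mathbb{T}_n$ of rank $k$, the length of the right arm of $T$ is $n-1-k$.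
   Context: $\mathbb{T}_n$ is the set of all full plane binary trees with $n$ leaves (every internal vertex has exactly a left child and a right child); the leaves are labeled $a_1,\ldots,a_n$ from left to right. For $T\in\mathbb{T}_n$, the reduced parenthesization $RP_T$ is the set of all subsets of $\{a_1,\ldots,a_n\}$ which are leaf sets of the subtrees of $T$ rooted at vertices of $T$ and which do not contain $a_n$. An element $E\in RP_T$ with $|E|>1$ is called a parenthesis pair. The (right) comb poset $\mathscr{C}_n$ is the set $\mathbb{T}_n$ ordered by $T_1\le T_2$ if and only if $RP_{T_1}\subseteq RP_{T_2}$. Its unique minimal element is the right comb tree $\mathrm{RCT}(n)=a_1(a_2(\cdots(a_{n-1}a_n)\cdots))$, which has no parenthesis pairs; hence two trees lie in a common interval exactly when they have a common upper bound. $\wedge,\vee$ denote meet and join in $\mathscr{C}_n$. Ranked means that for every $T$ all maximal chains from $\mathrm{RCT}(n)$ to $T$ have the same length, which is $\mathrm{rank}(T)$. The right arm of $T$ is the path induced by the vertices of $T$ that lie in the left subtree of no other vertex of $T$ (the path from the root to $a_n$); its length is its number of edges. *)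

(* Defs.v *)
From HB Require Import structures.
From mathcomp Require Import all_boot all_order ssralg ssrint zify.

Set Implicit Arguments.
Unset Strict Implicit.
Unset Printing Implicit Defensive.

Import Order.TTheory.
Local Open Scope order_scope.

Inductive btree := Leaf | Node of btree & btree.

Fixpoint encode_btree (t : btree) : GenTree.tree unit :=
  if t is Node l r then GenTree.Node 0 [:: encode_btree l; encode_btree r]
  else GenTree.Leaf tt.

Fixpoint decode_btree (s : GenTree.tree unit) : btree :=
  if s is GenTree.Node _ [:: l; r] then Node (decode_btree l) (decode_btree r)
  else Leaf.

Lemma encode_btreeK : cancel encode_btree decode_btree.
Proof. by elim=> //= l -> r ->. Qed.

HB.instance Definition _ := Countable.copy btree (can_type encode_btreeK).

Fixpoint nleaves (t : btree) : nat :=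
  if t is Node l r then (nleaves l + nleaves r)%N else 1%N.

Fixpoint right_arm (t : btree) : nat :=
  if t is Node _ r then (right_arm r).+1 else 0%N.

(* The leaf sets of the subtrees of t rooted at its vertices, when t sits in a
   tree with n leaves and i of them are to the left of t. The leaf a_(j+1) is
   represented by the element j of 'I_n. *)
Fixpoint leaf_sets n (i : nat) (t : btree) : seq {set 'I_n} :=
  [set j : 'I_n | (i <= j < i + nleaves t)%N] ::
  (if t is Node l r then leaf_sets n i l ++ leaf_sets n (i + nleaves l)%N r
   else [::]).

Record comb n := Comb { comb_tree :> btree; _ : nleaves comb_tree == n }.

HB.instance Definition _ n := [isSub for @comb_tree n].
HB.instance Definition _ n := [Countable of comb n by <:].

Lemma nleaves_comb n (T : comb n) : nleaves T = n.
Proof. exact/eqP/(valP T). Qed.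

Definition RP n (T : comb n) : {set {set 'I_n}} :=
  [set E | (E \in leaf_sets n 0 T) && [forall j in E, j.+1 != n]].

Definition paren_pairs n (T : comb n) : {set {set 'I_n}} :=
  [set E in RP T | (1 < #|E|)%N].

Fixpoint brackets (i : nat) (t : btree) : seq (nat * nat) :=
  (i, nleaves t) ::
  (if t is Node l r then brackets i l ++ brackets (i + nleaves l)%N r
   else [::]).

Lemma nleaves_gt0 t : (0 < nleaves t)%N.
Proof. by elim: t => //= l ? r ?; rewrite addn_gt0; apply/orP; left. Qed.

Lemma brackets_bound i t a m : (a, m) \in brackets i t ->
  [/\ (i <= a)%N, (0 < m)%N & (a + m <= i + nleaves t)%N].
Proof.
elim: t i => [|l IHl r IHr] i /=.
  by rewrite inE => /eqP [-> ->].
have := nleaves_gt0 l; have := nleaves_gt0 r => ? ?.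
rewrite inE mem_cat => /orP [/eqP [-> ->]|/orP [/IHl []|/IHr []]] *;
  by split; lia.
Qed.

Lemma brackets_self i t : (i, nleaves t) \in brackets i t.
Proof. by case: t => [|l r]; rewrite inE eqxx. Qed.

Lemma mem_brackets_l i l r a m : (a + m <= i + nleaves l)%N ->
  ((a, m) \in brackets i (Node l r)) = ((a, m) \in brackets i l).
Proof.
have l0 := nleaves_gt0 l; have r0 := nleaves_gt0 r => h.
rewrite /= inE mem_cat.
have -> : ((a, m) == (i, nleaves l + nleaves r)%N) = false.
  by apply/eqP => -[? ?]; lia.
case: (boolP ((a, m) \in brackets (i + nleaves l)%N r)); last by rewrite orbF.
by case/brackets_bound => *; lia.
Qed.

Lemma mem_brackets_r i l r a m : (i + nleaves l <= a)%N ->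
  ((a, m) \in brackets i (Node l r)) = ((a, m) \in brackets (i + nleaves l) r).
Proof.
have l0 := nleaves_gt0 l; have r0 := nleaves_gt0 r => h.
rewrite /= inE mem_cat.
have -> : ((a, m) == (i, nleaves l + nleaves r)%N) = false.
  by apply/eqP => -[? ?]; lia.
case: (boolP ((a, m) \in brackets i l)) => //=.
by case/brackets_bound => *; lia.
Qed.

Lemma brackets_left_le i l r l' r' :
    nleaves (Node l r) = nleaves (Node l' r') ->
    (forall a m, (a + m < i + nleaves (Node l r))%N ->
      ((a, m) \in brackets i (Node l r)) = ((a, m) \in brackets i (Node l' r'))) ->
  (nleaves l <= nleaves l')%N.
Proof.
move=> /= en H.
have l0 := nleaves_gt0 l; have r0 := nleaves_gt0 r.
have l0' := nleaves_gt0 l'.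
have := H i (nleaves l); rewrite mem_brackets_l // brackets_self.
move=> /(_ ltac:(lia))/esym; rewrite /= inE mem_cat.
case/orP => [/eqP [e]|/orP [] /brackets_bound []]; lia.
Qed.

Lemma brackets_inj i t t' : nleaves t = nleaves t' ->
    (forall a m, (a + m < i + nleaves t)%N ->
      ((a, m) \in brackets i t) = ((a, m) \in brackets i t')) ->
  t = t'.
Proof.
elim: t i t' => [|l IHl r IHr] i [|l' r'] //.
- by move=> /= en; have := nleaves_gt0 l'; have := nleaves_gt0 r'; lia.
- by move=> /= en; have := nleaves_gt0 l; have := nleaves_gt0 r; lia.
move=> en H.
have el : nleaves l = nleaves l'.
  apply/eqP; rewrite eqn_leq (brackets_left_le en H) /=.
  by apply: (brackets_left_le (esym en)) => a m h; apply/esym/H; rewrite en.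
have er : nleaves r = nleaves r' by move: en => /=; lia.
have r0 := nleaves_gt0 r.
congr Node.
- apply: (IHl i) => // a m h.
  have := H a m; rewrite (@mem_brackets_l i l r) ?(@mem_brackets_l i l' r');
    try lia.
  by apply => /=; lia.
- apply: (IHr (i + nleaves l)%N) => // a m h.
  have [ha|ha] := leqP (i + nleaves l)%N a; last first.
    by apply/idP/idP => /brackets_bound []; lia.
  have := H a m; rewrite (@mem_brackets_r i l r) // (@mem_brackets_r i l' r');
    last lia.
  by rewrite el; apply => /=; lia.
Qed.

Definition bracket_set n (p : nat * nat) : {set 'I_n} :=
  [set j : 'I_n | (p.1 <= j < p.1 + p.2)%N].

Lemma leaf_setsE n i t : leaf_sets n i t = map (bracket_set n) (brackets i t).
Proof. by elim: t i => //= l IHl r IHr i; rewrite map_cat IHl IHr. Qed.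

Lemma bracket_set_inj n a m b k :
    (0 < m)%N -> (a + m <= n)%N -> (0 < k)%N -> (b + k <= n)%N ->
  bracket_set n (a, m) = bracket_set n (b, k) -> (a, m) = (b, k).
Proof.
move=> m0 am k0 bk /setP e.
have E j : (j < n)%N -> ((a <= j < a + m) = (b <= j < b + k))%N.
  by move=> jn; have := e (Ordinal jn); rewrite !inE.
have := E a ltac:(lia); have := E b ltac:(lia).
have := E (a + m).-1 ltac:(lia); have := E (b + k).-1 ltac:(lia).
move=> *; suff [-> ->] : a = b /\ m = k by [].
lia.
Qed.

Lemma mem_RP_bracket n (T : comb n) a m : (0 < m)%N -> (a + m < n)%N ->
  (bracket_set n (a, m) \in RP T) = ((a, m) \in brackets 0 T).
Proof.
move=> m0 am; rewrite inE leaf_setsE.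
have -> : [forall j in bracket_set n (a, m), j.+1 != n].
  by apply/forall_inP => j; rewrite inE /=; lia.
rewrite andbT; apply/mapP/idP => [[[b k] h e]|h]; last by exists (a, m).
have [_ k0 bk] := brackets_bound h; rewrite nleaves_comb in bk.
by rewrite (@bracket_set_inj n a m b k) //; lia.
Qed.

Lemma RP_inj n : injective (@RP n).
Proof.
move=> T T' e; apply/val_inj/(@brackets_inj 0) => /=.
  by rewrite !nleaves_comb.
move=> a m; rewrite add0n nleaves_comb => h.
case: (posnP m) => [->|m0]; first by apply/idP/idP => /brackets_bound [].
by rewrite -!mem_RP_bracket // e.
Qed.

Definition comb_le n (T1 T2 : comb n) : bool := RP T1 \subset RP T2.

Lemma comb_le_refl n : reflexive (@comb_le n).
Proof. by move=> T; apply: subxx. Qed.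

Lemma comb_le_anti n : antisymmetric (@comb_le n).
Proof. by move=> T1 T2; rewrite /comb_le -eqEsubset => /eqP/RP_inj. Qed.

Lemma comb_le_trans n : transitive (@comb_le n).
Proof. by move=> T2 T1 T3; apply: subset_trans. Qed.

Fact comb_display : Order.disp_t. Proof. exact: Order.Disp tt tt. Qed.

HB.instance Definition _ n := Order.Le_isPOrder.Build comb_display (comb n)
  (@comb_le_refl n) (@comb_le_anti n) (@comb_le_trans n).

Fixpoint right_comb (m : nat) : btree :=
  if m is m'.+1 then Node Leaf (right_comb m') else Leaf.

Lemma nleaves_right_comb n : (0 < n)%N -> nleaves (right_comb n.-1) == n.
Proof.
by case: n => // n _; elim: n => //= n; rewrite add1n eqSS.
Qed.

Definition RCT n (n_gt0 : (0 < n)%N) : comb n :=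
  Comb (nleaves_right_comb n_gt0).

Section PosetNotions.
Context {d : Order.disp_t} {P : porderType d}.
Implicit Types x y z m j : P.

Definition is_meet x y m : Prop :=
  [/\ m <= x, m <= y & forall z, z <= x -> z <= y -> z <= m].

Definition is_join x y j : Prop :=
  [/\ x <= j, y <= j & forall z, x <= z -> y <= z -> j <= z].

Definition covers x y : Prop := y < x /\ forall z, ~ (y < z /\ z < x).

Definition in_interval x y : Prop :=
  exists a b, a <= x <= b /\ a <= y <= b.

(* The interval [a, b], with the induced order, is isomorphic to the poset of
   a distributive lattice. *)
Definition distr_lattice_interval (a b : P) : Prop :=
  exists (d' : Order.disp_t) (L : distrLatticeType d')
         (f : {x : P | a <= x <= b} -> L),
    bijective f /\ forall u v, (f u <= f v) = (val u <= val v).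

(* The sequence x :: s is the chain x < s_1 < ... < s_k = y, of length
   size s. *)
Definition chain x y (s : seq P) : bool := path <%O x s && (last x s == y).

Definition maximal_chain x y (s : seq P) : Prop :=
  chain x y s /\
  forall s', chain x y s' -> {subset x :: s <= x :: s'} -> s' = s.

(* All maximal chains from x0 to any x have the same length, namely rk x; one
   exists, so rk is determined by x0. *)
Definition is_rank (x0 : P) (rk : P -> nat) : Prop :=
  forall x, (exists s, maximal_chain x0 x s) /\
            (forall s, maximal_chain x0 x s -> size s = rk x).

End PosetNotions.

(* Main.v *)
(* If every leaf set of a binary tree is one of another tree on the same leaves,
   the two trees are equal; so for [T <= B] the subtrees of [T] off the right
   arm are subtrees of [B], and [RP T] is closed under passing to the members of [RP B]
   nested in one of its own. Conversely, every subset of [RP B] that contains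
   the singletons and is closed in this way is [RP T] for some [T]: keep the
   maximal subtrees of [B] that are selected and hang them on a right arm. The
   interval below [B] is thus a lattice of down-closed sets under union and
   intersection, and adding to [RP T2] a minimal element of [RP T1] not in it
   is a single step up, which makes the number of pairs a rank function. *)

From HB Require Import structures.
Require Import Defs.
From mathcomp Require Import all_boot all_order ssralg ssrint zify.

Set Implicit Arguments.
Unset Strict Implicit.
Unset Printing Implicit Defensive.

Import Order.TTheory.

(** * Nested leaf sets within a binary tree *)

Lemma brackets_NodeE i l r a m : (a + m < i + nleaves (Node l r))%N ->
  ((a, m) \in brackets i (Node l r)) =
  ((a, m) \in brackets i l) || ((a, m) \in brackets (i + nleaves l) r).
Proof.
move=> h; rewrite /= inE mem_cat; case: eqP => // -[ea em].
by move: h => /=; lia.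
Qed.

Lemma mem_brackets1 i t j : (i <= j < i + nleaves t)%N ->
  (j, 1%N) \in brackets i t.
Proof.
elim: t i => [|l IHl r IHr] i /=.
  by rewrite inE => h; apply/eqP; congr pair; lia.
rewrite inE mem_cat => h; apply/orP; right; apply/orP.
have [jl|jl] := ltnP j (i + nleaves l)%N.
  by left; apply: IHl; lia.
by right; apply: IHr; lia.
Qed.

(** The leaf set of [l] starts at the first leaf and is not everything, so it lies inside that of
    [l']; the leaf set of [r] ends at the last leaf, so it lies inside that of [r']. The sizes then
    force the same split at the root. *)
Lemma brackets_sub_eq i t t' : nleaves t = nleaves t' ->
  {subset brackets i t <= brackets i t'} -> t = t'.
Proof.
elim: t i t' => [|l IHl r IHr] i [|l' r'] //.
- by move=> /= en; have := nleaves_gt0 l'; have := nleaves_gt0 r'; lia.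
- by move=> /= en; have := nleaves_gt0 l; have := nleaves_gt0 r; lia.
move=> en sub; have /= en' := en.
have l0 := nleaves_gt0 l; have r0 := nleaves_gt0 r.
have l0' := nleaves_gt0 l'; have r0' := nleaves_gt0 r'.
have subl a m : (a, m) \in brackets i l -> (a, m) \in brackets i (Node l' r').
  by move=> h; apply: sub; rewrite /= inE mem_cat h orbT.
have subr a m : (a, m) \in brackets (i + nleaves l) r ->
    (a, m) \in brackets i (Node l' r').
  by move=> h; apply: sub; rewrite /= inE mem_cat h !orbT.
have el : nleaves l = nleaves l'.
  have := subl _ _ (brackets_self i l).
  have := subr _ _ (brackets_self (i + nleaves l) r).
  rewrite /= !inE !mem_cat !xpair_eqE.
  case/or3P => [/andP [/eqP ? _]|/brackets_bound [? _ ?]|/brackets_bound [? _ ?]];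
    try lia.
  by case/or3P => [/andP [_ /eqP ?]|/brackets_bound [? _ ?]
                  |/brackets_bound [? _ ?]]; lia.
have er : nleaves r = nleaves r' by lia.
congr Node.
- apply: (IHl i) => // -[a m] h; have [_ _ b] := brackets_bound h.
  by have := subl _ _ h; rewrite mem_brackets_l // -el.
- apply: (IHr (i + nleaves l)%N) => // -[a m] h; have [b _ _] := brackets_bound h.
  by have := subr _ _ h; rewrite mem_brackets_r -?el.
Qed.

(** The witness is the subtree spanning [(a, m)]. That it captures every bracket of [t] nested there
    allows two trees to be compared below a common leaf set. *)
Lemma brackets_subtree i t a m : (a, m) \in brackets i t ->
  exists s, [/\ nleaves s = m, {subset brackets a s <= brackets i t} &
    forall b k, (0 < k)%N -> (a <= b)%N -> (b + k <= a + m)%N ->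
      (b, k) \in brackets i t -> (b, k) \in brackets a s].
Proof.
elim: t i => [|l IHl r IHr] i /=.
  by rewrite inE => /eqP [-> ->]; exists Leaf; split.
rewrite inE mem_cat => /orP [/eqP [-> ->]|/orP [h|h]].
- by exists (Node l r); split.
- have [_ _ bl] := brackets_bound h.
  have [s [en sub mx]] := IHl _ h; exists s; split=> //.
    by move=> x /sub; rewrite inE mem_cat => ->; rewrite orbT.
  move=> b k k0 ab bk; rewrite -/(brackets i (Node l r)) mem_brackets_l; last lia.
  exact: mx.
- have [bl _ _] := brackets_bound h.
  have [s [en sub mx]] := IHr _ h; exists s; split=> //.
    by move=> x /sub; rewrite inE mem_cat => ->; rewrite !orbT.
  move=> b k k0 ab bk; rewrite -/(brackets i (Node l r)) mem_brackets_r; last lia.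
  exact: mx.
Qed.

(** * Elements of a reduced parenthesization as intervals of leaves *)

Lemma bracket_set_subset n a m b k : (0 < m)%N -> (a + m <= n)%N ->
    bracket_set n (a, m) \subset bracket_set n (b, k) ->
  (b <= a)%N /\ (a + m <= b + k)%N.
Proof.
move=> m0 am /subsetP s.
have E j : (j < n -> a <= j < a + m -> b <= j < b + k)%N.
  by move=> jn; have := s (Ordinal jn); rewrite !inE.
have := E a ltac:(lia) ltac:(lia).
by have := E (a + m).-1 ltac:(lia) ltac:(lia); lia.
Qed.

Lemma card_bracket_set n a m : (a + m <= n)%N -> #|bracket_set n (a, m)| = m.
Proof.
move=> am; pose f (j : 'I_m) := widen_ord am (rshift a j).
have -> : bracket_set n (a, m) = [set f j | j in 'I_m].
  apply/setP => j; rewrite inE /=; apply/idP/imsetP => [h|[k _ ->] /=].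
    have h' : (j - a < m)%N by lia.
    by exists (Ordinal h') => //; apply/val_inj => /=; lia.
  by have := ltn_ord k; lia.
rewrite card_imset ?card_ord // => j k /(congr1 val) /= e.
by apply/val_inj => /=; lia.
Qed.

Lemma RP_P n (T : comb n) (E : {set 'I_n}) :
  reflect (exists a m, [/\ (0 < m)%N, (a + m < n)%N, (a, m) \in brackets 0 T
                         & E = bracket_set n (a, m)])
          (E \in RP T).
Proof.
apply: (iffP idP) => [h|[a [m [m0 am h ->]]]]; last by rewrite mem_RP_bracket.
move: (h); rewrite inE leaf_setsE => /andP [/mapP [[a m] am e] /forall_inP lst].
exists a, m; have [_ m0 le] := brackets_bound am; rewrite nleaves_comb in le.
split=> //; rewrite ltn_neqAle le andbT; apply/eqP => eam.
(* An interval reaching the end would contain the last leaf, which [RP] excludes. *)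
have lt : ((a + m).-1 < n)%N by lia.
by have := lst (Ordinal lt); rewrite e inE /=; lia.
Qed.

Lemma RP_card_gt0 n (T : comb n) (E : {set 'I_n}) : E \in RP T -> (0 < #|E|)%N.
Proof. by case/RP_P => a [m [m0 am _ ->]]; rewrite card_bracket_set //; lia. Qed.

(** A leaf is a vertex of every tree, so the singletons in [RP] do not depend on the tree. *)
Lemma RP_card1 n (T T' : comb n) (E : {set 'I_n}) :
  #|E| = 1%N -> E \in RP T -> E \in RP T'.
Proof.
move=> E1 /RP_P [a [m [m0 am _ e]]]; move: E1.
rewrite e card_bracket_set; last lia.
by move=> m1; subst m; rewrite mem_RP_bracket ?mem_brackets1 // nleaves_comb; lia.
Qed.

Lemma comb_leE n (T1 T2 : comb n) : (T1 <= T2)%O = (RP T1 \subset RP T2).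
Proof. by []. Qed.

Lemma comb_ltE n (T1 T2 : comb n) : (T1 < T2)%O = (RP T1 \proper RP T2).
Proof.
rewrite lt_def comb_leE properEneq; congr andb.
by rewrite eq_sym; apply/idP/idP; apply: contra_neq; [apply: RP_inj|move->].
Qed.

(** Both [T] and [B] have a subtree with leaf set [E]. Since [E] avoids the last leaf, all leaf sets
    of the first subtree lie in [RP T], hence in [RP B], and [brackets_sub_eq] identifies the two
    subtrees. *)
Lemma RP_nested n (T B : comb n) (E F : {set 'I_n}) : (T <= B)%O ->
  E \in RP T -> F \in RP B -> F \subset E -> F \in RP T.
Proof.
rewrite comb_leE => /subsetP TB ET FB.
have := TB _ ET; have /RP_P [a [m [m0 am amT ->]]] := ET.
have /RP_P [b [k [k0 bk bkB ->]]] := FB.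
rewrite !mem_RP_bracket // => amB /(bracket_set_subset k0) [|ab abk]; first lia.
have [s [ns sub _]] := brackets_subtree amT.
have [s' [ns' _ mx']] := brackets_subtree amB.
suff e : s = s' by apply: sub; rewrite e; apply: mx'.
apply: (@brackets_sub_eq a); rewrite ?ns //.
move=> [c p] h; have [ac p0 cp] := brackets_bound h; rewrite ns in cp.
apply: mx' => //; rewrite -mem_RP_bracket //; last lia.
apply: TB; rewrite mem_RP_bracket //; [exact: sub|lia].
Qed.

(** * Realizing closed families of leaf sets by pruning *)

(* [prune P i t acc] hangs on a right arm ending in [acc] the maximal subtrees
   of [t] (placed after [i] leaves) that are leaves or satisfy [P]. *)
Fixpoint prune (P : nat * nat -> bool) (i : nat) (t acc : btree) : btree :=
  if t is Node l r then
    if P (i, nleaves t) then Node t acc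
    else prune P i l (prune P (i + nleaves l) r acc)
  else Node Leaf acc.

(** Leaf sets of vertices on the right arm contain the last leaf, so [P] is not tested there; only
    the subtrees hanging to the left are pruned. *)
Fixpoint prune_arm (P : nat * nat -> bool) (i : nat) (t : btree) : btree :=
  if t is Node l r then prune P i l (prune_arm P (i + nleaves l) r) else Leaf.

Lemma nleaves_prune P i t acc :
  nleaves (prune P i t acc) = (nleaves t + nleaves acc)%N.
Proof.
elim: t i acc => //= l IHl r IHr i acc.
by case: ifP => //= _; rewrite IHl IHr addnA.
Qed.

Lemma nleaves_prune_arm P i t : nleaves (prune_arm P i t) = nleaves t.
Proof. by elim: t i => //= l IHl r IHr i; rewrite nleaves_prune IHr. Qed.

(** Closure of [P] under nesting lets a kept subtree contribute all its brackets. The bound on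
    [a + m] leaves out the new right arm, whose brackets reach the end; [m == 1] is there because
    leaves always survive. *)
Lemma mem_prune (P : nat * nat -> bool) i t acc a m :
    (forall b k c p, (b, k) \in brackets i t -> (c, p) \in brackets i t ->
      (b <= c)%N -> (c + p <= b + k)%N -> P (b, k) -> P (c, p)) ->
    (a + m < i + nleaves t + nleaves acc)%N ->
  ((a, m) \in brackets i (prune P i t acc)) =
  ((a, m) \in brackets i t) && ((m == 1)%N || P (a, m)) ||
  ((a, m) \in brackets (i + nleaves t) acc).
Proof.
elim: t i acc => [|l IHl r IHr] i acc cl am.
  rewrite [LHS]brackets_NodeE /=; last by move: am => /=; lia.
  by congr orb; rewrite inE; case: eqP => // -[_ ->].
have inl x : x \in brackets i l -> x \in brackets i (Node l r).
  by rewrite /= inE mem_cat => ->; rewrite orbT.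
have inr x : x \in brackets (i + nleaves l) r -> x \in brackets i (Node l r).
  by rewrite /= inE mem_cat => ->; rewrite !orbT.
rewrite [prune _ _ _ _]/=; case: ifP => Pt.
  rewrite brackets_NodeE; last by move: am => /=; lia.
  congr orb; case: (boolP ((a, m) \in brackets i (Node l r))) => // h.
  have [ia _ b] := brackets_bound h.
  by rewrite (cl _ _ _ _ (brackets_self i (Node l r)) h ia b Pt) orbT.
have l0 := nleaves_gt0 l; have r0 := nleaves_gt0 r.
rewrite IHl; first last.
- by rewrite nleaves_prune; move: am => /=; lia.
- by move=> b k c p /inl ? /inl ?; apply: cl.
rewrite IHr; first last.
- by move: am => /=; lia.
- by move=> b k c p /inr ? /inr ?; apply: cl.
rewrite /= addnA [in RHS]inE mem_cat.
case: ((a, m) =P (i, nleaves l + nleaves r)%N) => [[ea em]|_] /=; last first.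
  by rewrite andb_orl orbA.
(* Here [(a, m)] is the bracket of the rejected root: it lies in neither child and is no leaf, so
   both sides reduce to [acc]. *)
have /negbTE -> : (a, m) \notin brackets i l.
  by apply/negP => /brackets_bound []; lia.
have /negbTE -> : (a, m) \notin brackets (i + nleaves l) r.
  by apply/negP => /brackets_bound []; lia.
have -> : (m == 1)%N = false by lia.
by rewrite ea em; move: Pt => /= ->.
Qed.

Lemma mem_prune_arm (P : nat * nat -> bool) i t a m :
    (forall b k c p, (b, k) \in brackets i t -> (c, p) \in brackets i t ->
      (b + k < i + nleaves t)%N ->
      (b <= c)%N -> (c + p <= b + k)%N -> P (b, k) -> P (c, p)) ->
    (a + m < i + nleaves t)%N ->
  ((a, m) \in brackets i (prune_arm P i t)) =
  ((a, m) \in brackets i t) && ((m == 1)%N || P (a, m)).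
Proof.
elim: t i => [|l IHl r IHr] i cl am.
  by rewrite /= inE; case: eqP => // -[_ ->].
have r0 := nleaves_gt0 r.
rewrite [prune_arm _ _ _]/= mem_prune; first last.
- by rewrite nleaves_prune_arm; move: am => /=; lia.
- move=> b k c p h h'; have [_ _ b1] := brackets_bound h; apply: cl => /=; last lia.
    by rewrite inE mem_cat h orbT.
  by rewrite inE mem_cat h' orbT.
rewrite IHr; first last.
- by move: am => /=; lia.
- move=> b k c p h h' b1; apply: cl => /=; last lia.
    by rewrite inE mem_cat h !orbT.
  by rewrite inE mem_cat h' !orbT.
by rewrite brackets_NodeE // andb_orl.
Qed.

(** The tree is [B] pruned by membership in [S]: closure under nesting is what [mem_prune_arm] asks
    of the selection, and [S] must have the singletons because pruning removes no leaf. *)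
Lemma RP_realize n (B : comb n) (S : {set {set 'I_n}}) :
    S \subset RP B ->
    (forall E, E \in RP B -> #|E| = 1%N -> E \in S) ->
    (forall E F, E \in S -> F \in RP B -> F \subset E -> F \in S) ->
  exists T : comb n, RP T = S.
Proof.
move=> /subsetP SB S1 cl; pose P p := bracket_set n p \in S.
have nT : nleaves (prune_arm P 0 B) == n by rewrite nleaves_prune_arm nleaves_comb.
exists (Comb nT).
have key a m : (0 < m)%N -> (a + m < n)%N ->
    (bracket_set n (a, m) \in RP (Comb nT)) = (bracket_set n (a, m) \in S).
  move=> m0 am; rewrite mem_RP_bracket //= mem_prune_arm ?nleaves_comb //.
    rewrite -mem_RP_bracket //; apply/andP/idP => [[h /orP [/eqP m1|//]]|h].
      by apply: S1 => //; rewrite card_bracket_set //; lia.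
    by rewrite /P h orbT SB.
  move=> b k c p h h' bk bc cp; have [_ p0 _] := brackets_bound h'.
  move=> /cl; apply; first by rewrite mem_RP_bracket //; lia.
  by apply/subsetP => j; rewrite !inE /=; lia.
apply/setP => E; apply/idP/idP => h.
  by have /RP_P [a [m [m0 am _ e]]] := h; move: h; rewrite e key.
by have /RP_P [a [m [m0 am _ e]]] := SB _ h; move: h; rewrite e key.
Qed.

(** * Meets, joins and the distributive lattice on an interval *)

Lemma RP_meet n (T1 T2 B : comb n) : (T1 <= B)%O -> (T2 <= B)%O ->
  exists T : comb n, RP T == RP T1 :&: RP T2.
Proof.
move=> h1 h2; have [|E EB E1|E F|T e] := @RP_realize n B (RP T1 :&: RP T2).
- by rewrite comb_leE in h1; apply: subset_trans h1; apply: subsetIl.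
- by rewrite in_setI !(RP_card1 _ E1 EB).
- by rewrite !in_setI => /andP [i1 i2] FB FE;
    rewrite (RP_nested h1 i1) ?(RP_nested h2 i2).
- by exists T; apply/eqP.
Qed.

Lemma RP_join n (T1 T2 B : comb n) : (T1 <= B)%O -> (T2 <= B)%O ->
  exists T : comb n, RP T == RP T1 :|: RP T2.
Proof.
move=> h1 h2; have [|E EB E1|E F|T e] := @RP_realize n B (RP T1 :|: RP T2).
- by rewrite subUset -!comb_leE h1.
- by rewrite in_setU (RP_card1 _ E1 EB).
- by rewrite !in_setU => /orP [i FB FE|i FB FE];
    rewrite ?(RP_nested h1 i) ?(RP_nested h2 i) ?orbT.
- by exists T; apply/eqP.
Qed.

Lemma RP_is_meet n (T1 T2 M : comb n) : RP M = RP T1 :&: RP T2 ->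
  is_meet T1 T2 M.
Proof.
by move=> e; split; rewrite ?comb_leE ?e ?subsetIl ?subsetIr // => z z1 z2;
   rewrite comb_leE e subsetI -!comb_leE z1.
Qed.

Lemma RP_is_join n (T1 T2 J : comb n) : RP J = RP T1 :|: RP T2 ->
  is_join T1 T2 J.
Proof.
by move=> e; split; rewrite ?comb_leE ?e ?subsetUl ?subsetUr // => z z1 z2;
   rewrite comb_leE e subUset -!comb_leE z1.
Qed.

Lemma paren_pairsE n (T : comb n) :
  paren_pairs T = RP T :&: [set E : {set 'I_n} | (1 < #|E|)%N].
Proof. by apply/setP => E; rewrite !inE. Qed.

Lemma paren_pairsI n (T1 T2 M : comb n) : RP M = RP T1 :&: RP T2 ->
  paren_pairs M = paren_pairs T1 :&: paren_pairs T2.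
Proof. by move=> e; rewrite !paren_pairsE e setIACA setIid. Qed.

Lemma paren_pairsU n (T1 T2 J : comb n) : RP J = RP T1 :|: RP T2 ->
  paren_pairs J = paren_pairs T1 :|: paren_pairs T2.
Proof. by move=> e; rewrite !paren_pairsE e setIUl. Qed.

(** The universal property of the meet keeps the tree above [A]. The equality is boolean so that
    [xchoose] can turn the statement into an operation. *)
Lemma interval_meet n (A B : comb n) (u v : {x : comb n | (A <= x <= B)%O}) :
  exists w : {x : comb n | (A <= x <= B)%O},
    RP (val w) == RP (val u) :&: RP (val v).
Proof.
case: u v => [x /[dup] xAB /andP [Ax xB]] [y /andP [Ay yB]] /=.
have [T /eqP e] := RP_meet xB yB.
have [Tx _ TM] := RP_is_meet e.
have TAB : (A <= T <= B)%O by rewrite TM // (le_trans Tx xB).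
by exists (exist _ T TAB); rewrite /= e.
Qed.

Lemma interval_join n (A B : comb n) (u v : {x : comb n | (A <= x <= B)%O}) :
  exists w : {x : comb n | (A <= x <= B)%O},
    RP (val w) == RP (val u) :|: RP (val v).
Proof.
case: u v => [x /[dup] xAB /andP [Ax xB]] [y /andP [Ay yB]] /=.
have [T /eqP e] := RP_join xB yB.
have [xT _ TJ] := RP_is_join e.
have TAB : (A <= T <= B)%O by rewrite TJ // (le_trans Ax xT).
by exists (exist _ T TAB); rewrite /= e.
Qed.

(** A named alias, so that the lattice instance is attached to this type and not to sigma types at
    large. *)
Definition comb_interval n (A B : comb n) : Type :=
  {x : comb n | (A <= x <= B)%O}.

Section IntervalLattice.
Context {n : nat} {A B : comb n}.
Implicit Types u v w : comb_interval A B.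

HB.instance Definition _ :=
  Choice.copy (comb_interval A B) {x : comb n | (A <= x <= B)%O}.

Definition interval_le u v : bool := (sval u <= sval v)%O.
Definition imeet u v : comb_interval A B := xchoose (interval_meet u v).
Definition ijoin u v : comb_interval A B := xchoose (interval_join u v).

Lemma RP_imeet u v : RP (sval (imeet u v)) = RP (sval u) :&: RP (sval v).
Proof. exact/eqP/(xchooseP (interval_meet u v)). Qed.

Lemma RP_ijoin u v : RP (sval (ijoin u v)) = RP (sval u) :|: RP (sval v).
Proof. exact/eqP/(xchooseP (interval_join u v)). Qed.

(** Reduces each lattice law to the same law for [:&:] and [:|:]. *)
Lemma RP_interval_inj : injective (fun u => RP (sval u)).
Proof. by move=> u v /RP_inj /val_inj. Qed.

Let RPE := (RP_imeet, RP_ijoin).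

Lemma interval_leE u v : interval_le u v = (imeet u v == u).
Proof.
rewrite /interval_le comb_leE; apply/setIidPl/eqP => [e|<-]; last first.
  by rewrite RPE -setIA setIid.
by apply: RP_interval_inj; rewrite RPE.
Qed.

Lemma imeetC : commutative imeet.
Proof. by move=> u v; apply: RP_interval_inj; rewrite !RPE setIC. Qed.

Lemma ijoinC : commutative ijoin.
Proof. by move=> u v; apply: RP_interval_inj; rewrite !RPE setUC. Qed.

Lemma imeetA : associative imeet.
Proof. by move=> u v w; apply: RP_interval_inj; rewrite !RPE setIA. Qed.

Lemma ijoinA : associative ijoin.
Proof. by move=> u v w; apply: RP_interval_inj; rewrite !RPE setUA. Qed.

Lemma ijoinKI v u : imeet u (ijoin u v) = u.
Proof. by apply: RP_interval_inj; rewrite !RPE setUC setKU. Qed.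

Lemma imeetKU v u : ijoin u (imeet u v) = u.
Proof. by apply: RP_interval_inj; rewrite !RPE setIC setKI. Qed.

Lemma imeetUl : left_distributive imeet ijoin.
Proof. by move=> u v w; apply: RP_interval_inj; rewrite !RPE setIUl. Qed.

Lemma imeetxx : idempotent_op imeet.
Proof. by move=> u; apply: RP_interval_inj; rewrite !RPE setIid. Qed.

HB.instance Definition _ :=
  Order.isMeetJoinDistrLattice.Build comb_display (comb_interval A B)
    interval_leE (fun _ _ => erefl) imeetC ijoinC imeetA ijoinA ijoinKI imeetKU
    imeetUl imeetxx.

End IntervalLattice.

Lemma comb_distr_lattice_interval n (A B : comb n) : distr_lattice_interval A B.
Proof.
by exists comb_display, (comb_interval A B), id; split=> //; exists id.
Qed.

(** * Single steps and the covering relation *)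

(** For [E] of least size in [RP T1] outside [RP T2], the members of [RP T1] strictly inside [E] are
    already in [RP T2]; so adding [E] keeps the family closed in [T1]. *)
Lemma comb_lt_step n (T1 T2 : comb n) : (T2 < T1)%O ->
  exists (E : {set 'I_n}) (T : comb n), [/\ (1 < #|E|)%N, E \notin RP T2, RP T = E |: RP T2
    & (T <= T1)%O].
Proof.
rewrite comb_ltE properE => /andP [s /subsetPn [E0 E01 E02]].
pose D E := (E \in RP T1) && (E \notin RP T2).
have DE0 : D E0 by rewrite /D E01.
case: (@arg_minnP _ E0 D (fun E => #|E|) DE0) => E /andP [E1 E2] min.
have [|F F1 F1'|F G|T eT] := @RP_realize n T1 (E |: RP T2).
- by rewrite subUset sub1set E1.
- by rewrite in_setU1 (RP_card1 _ F1' F1) orbT.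
- rewrite !in_setU1 => /orP [/eqP -> G1|F2 G1 GF]; last first.
    by rewrite (RP_nested _ F2 G1 GF) ?orbT.
  rewrite subEproper => /orP [/eqP ->|/proper_card GE]; first by rewrite eqxx.
  apply/orP; right; apply: contraTT GE => G2; rewrite -leqNgt.
  by apply: min; rewrite /D G1.
exists E, T; split=> //; last by rewrite comb_leE eT subUset sub1set E1.
(* A singleton [E] would already belong to [RP T2]. *)
rewrite ltn_neqAle (RP_card_gt0 E1) andbT eq_sym.
by apply: contraNneq E2 => e; apply: RP_card1 E1.
Qed.

Lemma card_paren_pairsU1 n (T T' : comb n) (E : {set 'I_n}) :
  (1 < #|E|)%N -> E \notin RP T ->
  RP T' = E |: RP T -> #|paren_pairs T'| = #|paren_pairs T|.+1.
Proof.
move=> E1 ET e; have -> : paren_pairs T' = E |: paren_pairs T.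
  by apply/setP => F; rewrite !paren_pairsE e !inE; case: eqP => //= ->; rewrite E1.
by rewrite cardsU1 paren_pairsE in_setI (negbTE ET).
Qed.

Lemma card_paren_pairs_lt n (T1 T2 : comb n) :
  (T1 < T2)%O -> (#|paren_pairs T1| < #|paren_pairs T2|)%N.
Proof.
move=> /comb_lt_step [E [T [E1 ET eT]]]; rewrite comb_leE => TT2.
rewrite -(card_paren_pairsU1 E1 ET eT) !paren_pairsE.
exact/subset_leq_card/setSI.
Qed.

(** A cover must equal the single step towards it; conversely, a difference of one in the number of
    pairs leaves no room for a tree in between. *)
Lemma comb_coversP n (T1 T2 : comb n) :
  covers T1 T2 <->
  exists E : {set 'I_n}, [/\ (1 < #|E|)%N, E \notin RP T2 & RP T1 = E |: RP T2].
Proof.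
split=> [[lt nb]|[E [E1 E2 e]]].
  have [E [T [E1 ET eT]]] := comb_lt_step lt.
  rewrite le_eqVlt => /orP [/eqP <-|T1T]; first by exists E.
  by case: (nb T); split=> //; rewrite comb_ltE eT properUr // sub1set.
split=> [|z [/card_paren_pairs_lt + /card_paren_pairs_lt]].
  by rewrite comb_ltE e properUr // sub1set.
by rewrite (card_paren_pairsU1 E1 E2 e); lia.
Qed.

(** * A rank criterion for arbitrary posets *)

Section GradedPoset.
Context {d : Order.disp_t} {P : porderType d} {rk : P -> nat}.
Hypothesis rk_lt : forall x y : P, (x < y)%O -> (rk x < rk y)%N.
Hypothesis rk_step : forall x y : P, (x < y)%O ->
  exists z, [/\ (x < z)%O, (z <= y)%O & rk z = (rk x).+1].

Lemma chain_size_le x y s : chain x y s -> (rk x + size s <= rk y)%N.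
Proof.
rewrite /chain; elim: s x => [|z s IHs] x /=; first by move/eqP->; rewrite addn0.
by rewrite -andbA => /andP [/rk_lt xz /IHs]; lia.
Qed.

(** By [chain_size_le] a refinement cannot be longer, so it has the same elements; sorted sequences
    with the same elements are equal. *)
Lemma saturated_maximal_chain x y s :
  chain x y s -> (rk x + size s = rk y)%N -> maximal_chain x y s.
Proof.
move=> c e; split=> // s' c' sub.
have := chain_size_le c'; rewrite -e leq_add2l => le.
have sorted_chain r : chain x y r -> sorted <%O%O (x :: r) by case/andP.
have [_ eqs] := uniq_min_size (lt_sorted_uniq (sorted_chain _ c)) sub le.
by have [] := lt_sorted_eq (sorted_chain _ c') (sorted_chain _ c) (fsym eqs).
Qed.

Lemma exists_saturated_chain x y : (x <= y)%O ->
  exists s, chain x y s /\ (rk x + size s = rk y)%N.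
Proof.
have [k] := ubnP (rk y - rk x); elim: k x => // k IHk x lek.
rewrite le_eqVlt => /orP [/eqP <-|xy].
  by exists [::]; rewrite /chain /= eqxx addn0.
have [z [xz zy ez]] := rk_step xy; have := rk_lt xy => ?.
have [|s [c e]] := IHk z _ zy; first lia.
by exists (z :: s); rewrite /chain /= xz; split=> //; lia.
Qed.

(** The first link of a maximal chain raises [rk] by exactly one, as otherwise the element given by
    [rk_step] could be inserted. *)
Lemma maximal_chain_size x y s : maximal_chain x y s -> (rk x + size s = rk y)%N.
Proof.
elim: s x => [|z s IHs] x []; rewrite /chain /=.
  by move=> /eqP -> _; rewrite addn0.
rewrite -andbA => /and3P [xz p l] mx.
have [w [xw wz ew]] := rk_step xz.
have ewz : w = z.
  apply/eqP; move: wz; rewrite le_eqVlt => /orP [//|wz].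
  have c : chain x y [:: w, z & s] by rewrite /chain /= xw wz p.
  have sub : {subset [:: x, z & s] <= [:: x, w, z & s]}.
    by move=> v; rewrite !inE => /or3P [] ->; rewrite ?orbT.
  by have /(congr1 size) /= := mx _ c sub; lia.
suff /IHs : maximal_chain z y s by rewrite -ewz ew; lia.
(* The tail is maximal too: a refinement of it refines the whole chain once [z] is put in front. *)
split=> [|s' /andP [p' l'] sub]; first by rewrite /chain p.
have c : chain x y (z :: s') by rewrite /chain /= xz p'.
have sub' : {subset [:: x, z & s] <= [:: x, z & s']}.
  by move=> v; rewrite ![v \in x :: _]inE => /orP [->//|/sub ->]; rewrite orbT.
by case: (mx _ c sub').
Qed.

Lemma graded_is_rank x0 : rk x0 = 0%N -> (forall x, (x0 <= x)%O) ->
  is_rank x0 rk.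
Proof.
move=> r0 le0 x; split=> [|s /maximal_chain_size]; last by rewrite r0.
have [s [c e]] := exists_saturated_chain (le0 x).
by exists s; apply: saturated_maximal_chain.
Qed.

End GradedPoset.

(** * The right comb as the least element, of rank zero *)

(** All internal vertices of the right comb lie on its right arm, so only leaves have brackets
    ending early. *)
Lemma mem_brackets_right_comb i k a m : (a + m < i + k.+1)%N ->
  (a, m) \in brackets i (right_comb k) -> m = 1%N.
Proof.
elim: k i => [|k IHk] i h; first by rewrite inE => /eqP [].
rewrite brackets_NodeE; last first.
  by have /eqP := @nleaves_right_comb k.+1 isT; move=> /= ->; lia.
by rewrite inE => /orP [/eqP []//|/IHk]; apply; move: h => /=; lia.
Qed.

Lemma card1_RP_RCT n (n_gt0 : (0 < n)%N) (E : {set 'I_n}) :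
  E \in RP (RCT n_gt0) -> #|E| = 1%N.
Proof.
case/RP_P => a [m [_ am /mem_brackets_right_comb h ->]].
by rewrite card_bracket_set; [apply: h|]; lia.
Qed.

Lemma RCT_le n (n_gt0 : (0 < n)%N) (T : comb n) : (RCT n_gt0 <= T)%O.
Proof.
rewrite comb_leE; apply/subsetP => E ER.
exact: RP_card1 (card1_RP_RCT ER) ER.
Qed.

Lemma card_paren_pairs_RCT n (n_gt0 : (0 < n)%N) :
  #|paren_pairs (RCT n_gt0)| = 0%N.
Proof.
apply/eqP; rewrite cards_eq0 paren_pairsE -subset0; apply/subsetP => E.
by rewrite in_setI => /andP [/card1_RP_RCT E1]; rewrite inE E1.
Qed.

(** * Number of pairs and length of the right arm *)

Lemma brackets_uniq i t : uniq (brackets i t).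
Proof.
elim: t i => //= l IHl r IHr i.
have l0 := nleaves_gt0 l; have r0 := nleaves_gt0 r.
rewrite mem_cat cat_uniq IHl IHr andbT /=; apply/andP; split.
  by apply/negP => /orP [] /brackets_bound []; lia.
by apply/hasPn => -[a m] /brackets_bound [? ? ?];
   apply/negP => /brackets_bound []; lia.
Qed.

(** The classical count of internal vertices, which are the brackets longer than 1. *)
Lemma count_internal i t :
  (count (fun p => 1 < p.2)%N (brackets i t)).+1 = nleaves t.
Proof.
elim: t i => //= l IHl r IHr i; rewrite count_cat.
have l0 := nleaves_gt0 l; have r0 := nleaves_gt0 r.
by have := IHl i; have := IHr (i + nleaves l)%N; lia.
Qed.

(* The internal vertices whose leaf set contains the last leaf are those of the
   right arm. *)
Lemma count_right_arm i t :
  (count (fun p => (1 < p.2) && (p.1 + p.2 < i + nleaves t)) (brackets i t)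
    + right_arm t).+1%N = nleaves t.
Proof.
elim: t i => [|l _ r IHr] i /=; first by [].
have l0 := nleaves_gt0 l; have r0 := nleaves_gt0 r.
rewrite ltnn andbF add0n count_cat.
(* The left subtree never reaches the last leaf, so all its internal vertices are counted. *)
have -> : count (fun p => (1 < p.2) && (p.1 + p.2 < i + (nleaves l + nleaves r)))%N
    (brackets i l) = count (fun p => 1 < p.2)%N (brackets i l).
  by apply: eq_in_count => -[a m] /brackets_bound [] /=; lia.
by have := IHr (i + nleaves l)%N; have := count_internal i l; rewrite addnA; lia.
Qed.

(** Distinct brackets give distinct leaf sets, so the pairs can be counted as the internal vertices
    off the right arm. *)
Lemma card_paren_pairs n (T : comb n) : (#|paren_pairs T| + right_arm T).+1 = n.
Proof.
rewrite -[RHS](nleaves_comb T) -(count_right_arm 0 T) -size_filter.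
set s := filter _ _; congr (_ + _).+1.
have sP a m :
    (a, m) \in s = [&& (1 < m)%N, (a + m < n)%N & (a, m) \in brackets 0 T].
  by rewrite mem_filter /= nleaves_comb andbA.
rewrite -(size_map (bracket_set n)).
have -> : paren_pairs T = [set E in map (bracket_set n) s].
  apply/setP => E; rewrite paren_pairsE [RHS]in_set.
  apply/setIP/mapP => [[/RP_P [a [m [m0 am h ->]]]]|[[a m]]].
    rewrite in_set card_bracket_set; last lia.
    by move=> m1; exists (a, m) => //; rewrite sP m1 am.
  rewrite sP => /and3P [m1 am h] ->.
  by split; [rewrite mem_RP_bracket|rewrite in_set card_bracket_set] => //; lia.
rewrite cardsE; apply/card_uniqP.
rewrite map_inj_in_uniq ?filter_uniq ?brackets_uniq //.
move=> [a m] [b k]; rewrite !sP => /and3P [? ? _] /and3P [? ? _].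
by apply: bracket_set_inj; lia.
Qed.

Theorem corollary2p12 (n : nat) (n_ge2 : (2 <= n)%N) :
  [/\ (* (i) *)
      forall A B : comb n, (A <= B)%O ->
        distr_lattice_interval A B /\
        forall T1 T2 : comb n, (A <= T1 <= B)%O -> (A <= T2 <= B)%O ->
          exists M J : comb n,
            [/\ (A <= M <= B)%O /\ (A <= J <= B)%O,
                is_meet T1 T2 M,
                is_join T1 T2 J,
                RP M = RP T1 :&: RP T2 /\
                paren_pairs M = paren_pairs T1 :&: paren_pairs T2
              & RP J = RP T1 :|: RP T2 /\
                paren_pairs J = paren_pairs T1 :|: paren_pairs T2],
      (* (ii) *)
      forall T1 T2 : comb n,
        covers T1 T2 <->
        exists E : {set 'I_n},
          [/\ (1 < #|E|)%N, E \notin RP T2 & RP T1 = E |: RP T2]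
    & (* (iii), (iv), (v) *)
      exists rank : comb n -> nat,
        [/\ is_rank (RCT (ltnW n_ge2)) rank,
            forall T : comb n, rank T = #|paren_pairs T|,
            forall T1 T2 : comb n, in_interval T1 T2 ->
              exists M J : comb n,
                [/\ is_meet T1 T2 M, is_join T1 T2 J
                  & (rank T1 + rank T2 = rank M + rank J)%N]
          & forall (T : comb n) (k : nat), rank T = k ->
              ((right_arm T)%:Z = n%:Z - 1 - k%:Z)%R]].
Proof.
split=> [A B _|T1 T2|]; last exists (fun T => #|paren_pairs T|).
- split=> [|T1 T2 h1 h2]; first exact: comb_distr_lattice_interval.
  have [M /eqP /= eM] := interval_meet (exist _ T1 h1) (exist _ T2 h2).
  have [J /eqP /= eJ] := interval_join (exist _ T1 h1) (exist _ T2 h2).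
  exists (val M), (val J); split; first by rewrite (valP M) (valP J).
  + exact: RP_is_meet.
  + exact: RP_is_join.
  + by rewrite eM (paren_pairsI eM).
  + by rewrite eJ (paren_pairsU eJ).
- exact: comb_coversP.
- split=> // [|T1 T2 [A [B [/andP [_ h1] /andP [_ h2]]]]|T k <-].
  + apply: graded_is_rank => [|T1 T2 /comb_lt_step [E [T [E1 ET eT TT2]]]||].
    * exact: card_paren_pairs_lt.
    * exists T; split=> //; last exact: card_paren_pairsU1 eT.
      by rewrite comb_ltE eT properUr // sub1set.
    * exact: card_paren_pairs_RCT.
    * exact: RCT_le.
  + have [M /eqP eM] := RP_meet h1 h2; have [J /eqP eJ] := RP_join h1 h2.
    exists M, J; split; [exact: RP_is_meet|exact: RP_is_join|].
    (* The rank identity is inclusion-exclusion for the two sets of pairs. *)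
    by rewrite (paren_pairsI eM) (paren_pairsU eJ) [RHS]addnC cardsUI.
  + by have := card_paren_pairs T; lia.
Qed.
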